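(* Let $\omega>0$ and let $A,B,C$ be real constants. Set $R=\sqrt{B^2+C^2}$, let $\varphi$ be the phase for which $$\alpha(t)=A+B\cos(2\omega t)+C\sin(2\omega t)=A+R\cos(2\omega t-\varphi),$$ and assume $A>R$. Let $g(t)=\alpha(t)^{-5/2}$ and consider the equation $$z''+\omega^2 z+g(t)\,z^2=0,\qquad p=z'.$$ Set $$z_{\mathrm{crit}}(\omega)=\frac{\omega^2}{2}\,(A-R)(A+R)^{3/2}.$$ For initial conditions $p(0)=0$, $z(0)=z_0$, the motion is bounded as long as $z_0<z_{\mathrm{crit}}(\omega)$. Above this threshold the stroboscopic curve (given in the context) opens and the trajectory leaves the bounded domain.
   Context: The stroboscopic curve associated with the equation and the initial condition $z(0)=z_0$, $p(0)=0$, for the section at times $t_k=k\pi/\omega$, is the curve in the $(z,p)$-plane $$(A+R)\,p^2+\omega^2(A-R)\,z^2+\tfrac{2}{3}(A+R)^{-3/2}z^3=I_0,$$ where $$I_0=\omega^2(A-R)\,z_0^2+\tfrac{2}{3}(A+R)^{-3/2}z_0^3.$$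
   Formalization: Boundedness below z_crit is stated only for release from rest when α is at its maximum A+R (φ = 0 for release at time 0; in general at a time s with cos(2ωs−φ)=1) and for z_0 ≥ −2 z_crit; without these conditions the claim is false. *)

(* Defs.v *)
From Stdlib Require Import Reals Lra.
From Coquelicot Require Import Coquelicot.
Open Scope R_scope.

Definition amplitude (B C : R) : R := sqrt (B ^ 2 + C ^ 2).

Definition alpha (omega A B C t : R) : R :=
  A + B * cos (2 * omega * t) + C * sin (2 * omega * t).

Definition g (omega A B C t : R) : R :=
  Rpower (alpha omega A B C t) (- (5 / 2)).

Definition z_crit (omega A Rad : R) : R :=
  omega ^ 2 / 2 * (A - Rad) * Rpower (A + Rad) (3 / 2).

(** [z'' + omega^2 z + g(t) z^2 = 0] with [p = z'], on the open interval
    [(a, b)], released from rest at [z0] at time [s]. *)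
Definition motion (omega A B C s z0 : R) (a b : Rbar) (z p : R -> R) : Prop :=
  Rbar_lt a s /\ Rbar_lt s b /\
  z s = z0 /\ p s = 0 /\
  forall t : R, Rbar_lt a t -> Rbar_lt t b ->
    is_derive z t (p t) /\
    is_derive p t (- (omega ^ 2 * z t + g omega A B C t * z t ^ 2)).

(** Solutions may blow up in finite time, so the motion is taken on its maximal
    interval of existence; the values of [z] and [p] outside [(a, b)] are
    irrelevant. *)
Definition maximal_motion (omega A B C s z0 : R) (a b : Rbar) (z p : R -> R)
  : Prop :=
  motion omega A B C s z0 a b z p /\
  forall (a' b' : Rbar) (z' p' : R -> R),
    motion omega A B C s z0 a' b' z' p' -> Rbar_le a a' /\ Rbar_le b' b.

Definition bounded_set (D : R * R -> Prop) : Prop :=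
  exists M : R, forall q : R * R, D q -> Rabs (fst q) <= M /\ Rabs (snd q) <= M.

Definition forward_orbit (s : R) (b : Rbar) (z p : R -> R) (q : R * R) : Prop :=
  exists t : R, s <= t /\ Rbar_lt t b /\ q = (z t, p t).

(** A bounded motion is in particular defined for all later times. *)
Definition bounded_motion (s : R) (b : Rbar) (z p : R -> R) : Prop :=
  b = p_infty /\ bounded_set (forward_orbit s b z p).

Definition leaves_bounded_domains (s : R) (b : Rbar) (z p : R -> R) : Prop :=
  forall D : R * R -> Prop, bounded_set D ->
    exists q : R * R, forward_orbit s b z p q /\ ~ D q.

(** The curve on which the points [(z, p)] of the motion lie at the section
    times [s + k PI / omega], when [alpha] takes its maximum [A + Rad] there. *)
Definition stroboscopic_curve (omega A Rad z0 : R) (q : R * R) : Prop :=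
  let z := fst q in
  let p := snd q in
  let c := 2 / 3 * Rpower (A + Rad) (- (3 / 2)) in
  (A + Rad) * p ^ 2 + omega ^ 2 * (A - Rad) * z ^ 2 + c * z ^ 3
  = omega ^ 2 * (A - Rad) * z0 ^ 2 + c * z0 ^ 3.

(** Path component of [q0] in the plane set [S]. *)
Definition branch (S : R * R -> Prop) (q0 q : R * R) : Prop :=
  exists gamma : R -> R * R,
    (forall u : R, continuous gamma u) /\
    gamma 0 = q0 /\ gamma 1 = q /\
    forall u : R, 0 <= u <= 1 -> S (gamma u).

(** Being cubic in [z], the curve always has an unbounded branch escaping to
    [z = - oo]; it is open when this is the branch of the initial point
    [(z0, 0)], and closed when the latter lies on a bounded oval. *)
Definition curve_open (omega A Rad z0 : R) : Prop :=
  ~ bounded_set (branch (stroboscopic_curve omega A Rad z0) (z0, 0)).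

(* Main.v *)
Require Import Defs.
From Stdlib Require Import Reals Ranalysis5 Lra Psatz Classical.
From Coquelicot Require Import Coquelicot.
Open Scope R_scope.

(** The time-dependent equation is an autonomous one in disguise. Set
    [y = z / sqrt alpha] and introduce the time [tau] with [dtau = dt / alpha].
    Since [alpha'' = 4 omega^2 (A - alpha)], the equation becomes
    [y'' + K y + y^2 = 0] with the constant [K = omega^2 (A^2 - R^2)], where [R]
    is [amplitude B C] ([motion_rescaled_flow]). The energy
    [v^2 / 2 + K y^2 / 2 + y^3 / 3] is conserved. Its potential has a well at
    [y = 0], bounded on the left by the saddle [y = - K] of level [K^3 / 6] and on
    the right by [y = K / 2], the other point of that level. At a maximum of
    [alpha], where [z = sqrt (A + R) y], the well is the interval from
    [- 2 z_crit] to [z_crit], and the stroboscopic curve is an energy level.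

    Below the threshold the energy confines [y] to the well; at the end point
    [- 2 z_crit] the motion rests at the saddle ([trapped_in_well]). Above the
    threshold the energy exceeds the saddle level: the energy level contains an
    arc to [y = - oo], which opens the curve ([supercritical_curve_open]), and a
    Lyapunov function that grows at a definite rate along bounded motions shows
    that no motion stays bounded for all time ([supercritical_unbounded]).

    Both parts need that a bounded maximal motion is defined for all later times
    ([bounded_maximal_motion_global]). This follows from the global existence
    theorem [picard_lindelof], applied to the equation with a cut-off force, and
    from uniqueness ([lipschitz_uniqueness]). *)

(** * Global existence for Lipschitz forces *)

Lemma derive_nonneg_le :
  forall (f df : R -> R) (a b : R), a <= b ->
    (forall x, a <= x <= b -> is_derive f x (df x)) ->
    (forall x, a <= x <= b -> 0 <= df x) ->
    f a <= f b.
Proof.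
  intros f df a b Hab Hd Hpos.
  destruct (MVT_gen f a b df) as [c [Hc Heq]].
  - intros x Hx. rewrite Rmin_left, Rmax_right in Hx by lra. apply Hd; lra.
  - intros x Hx. rewrite Rmin_left, Rmax_right in Hx by lra.
    apply derivable_continuous_pt. exists (df x). apply is_derive_Reals, Hd; lra.
  - rewrite Rmin_left, Rmax_right in Hc by lra.
    assert (H := Hpos c Hc). nra.
Qed.

(** Gronwall's inequality in the form needed for uniqueness: [u exp (- C t)] is
    nonincreasing, so a nonnegative [u] that starts at zero stays there. *)
Lemma gronwall_zero :
  forall (u du : R -> R) (C a b : R), a <= b ->
    (forall x, a <= x <= b -> is_derive u x (du x)) ->
    (forall x, a <= x <= b -> 0 <= u x) ->
    (forall x, a <= x <= b -> du x <= C * u x) ->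
    u a = 0 -> u b = 0.
Proof.
  intros u du C a b Hab Hd Hpos Hle Ha.
  assert (H : - (u a * exp (- C * a)) <= - (u b * exp (- C * b))).
  { apply (derive_nonneg_le (fun x => - (u x * exp (- C * x)))
             (fun x => (C * u x - du x) * exp (- C * x))); [exact Hab| |].
    - intros x Hx. assert (D := Hd x Hx).
      auto_derive; [now exists (du x)|].
      replace (Derive (fun x => u x) x) with (du x)
        by (symmetry; now apply is_derive_unique).
      ring.
    - intros x Hx. assert (H1 := Hle x Hx). assert (H2 := exp_pos (- C * x)). nra. }
  rewrite Ha in H.
  assert (H0 := Hpos b ltac:(lra)). assert (H2 := exp_pos (- C * b)). nra.
Qed.

(** Picard iteration converges on the whole line, in one step and without
    patching intervals, when functions are compared with a multiple of
    [2 cosh (k (t - s))]: it grows in both time directions, and integration from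
    [s] divides such a bound by [k]. *)
Definition weight (k s t : R) : R := exp (k * (t - s)) + exp (- (k * (t - s))).

Lemma weight_ge_1 : forall k s t, 1 <= weight k s t.
Proof.
  intros k s t. unfold weight.
  assert (H1 := exp_ineq1_le (k * (t - s))).
  assert (H2 := exp_ineq1_le (- (k * (t - s)))). lra.
Qed.

(** [weight] is the derivative of [2 sinh (k (t - s)) / k], which vanishes at [s]
    and is at most [weight / k] in absolute value; [G] is compared with it on both
    sides of [s]. *)
Lemma weight_bound :
  forall (G f : R -> R) (k s B : R), 0 < k ->
    (forall t, is_derive G t (f t)) -> G s = 0 ->
    (forall t, Rabs (f t) <= B * weight k s t) ->
    forall t, Rabs (G t) <= B / k * weight k s t.
Proof.
  intros G f k s B Hk Hd H0 Hf t.
  set (H := fun t => B / k * (exp (k * (t - s)) - exp (- (k * (t - s))))).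
  assert (HH : forall x, is_derive H x (B * weight k s x)).
  { intro x. unfold H, weight. auto_derive; [trivial|]. unfold Rminus. field. lra. }
  assert (Hs : H s = 0).
  { unfold H. replace (k * (s - s)) with 0 by ring. rewrite Ropp_0. ring. }
  assert (HB : 0 <= B / k).
  { apply Rdiv_le_0_compat; [|exact Hk].
    assert (P := Hf s). assert (Q := Rabs_pos (f s)).
    assert (W := weight_ge_1 k s s). nra. }
  assert (Dm : forall x, is_derive (fun x => H x - G x) x (B * weight k s x - f x)).
  { intro x. apply (is_derive_minus H G); auto. }
  assert (Dp : forall x, is_derive (fun x => H x + G x) x (B * weight k s x + f x)).
  { intro x. apply (is_derive_plus H G); auto. }
  assert (Pm : forall x, 0 <= B * weight k s x - f x).
  { intro x. assert (Q := Hf x). apply Rabs_le_between in Q. lra. }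
  assert (Pp : forall x, 0 <= B * weight k s x + f x).
  { intro x. assert (Q := Hf x). apply Rabs_le_between in Q. lra. }
  assert (Hw : Rabs (H t) <= B / k * weight k s t).
  { unfold H, weight. rewrite Rabs_mult, (Rabs_pos_eq (B / k)) by exact HB.
    apply Rmult_le_compat_l; [exact HB|].
    assert (E1 := exp_pos (k * (t - s))). assert (E2 := exp_pos (- (k * (t - s)))).
    apply Rabs_le. lra. }
  apply Rabs_le_between in Hw. apply Rabs_le.
  destruct (Rle_dec s t) as [Hst|Hst].
  - assert (Q1 := derive_nonneg_le _ _ s t Hst (fun x _ => Dm x) (fun x _ => Pm x)).
    assert (Q2 := derive_nonneg_le _ _ s t Hst (fun x _ => Dp x) (fun x _ => Pp x)).
    simpl in Q1, Q2. lra.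
  - assert (Hts : t <= s) by lra.
    assert (Q1 := derive_nonneg_le _ _ t s Hts (fun x _ => Dm x) (fun x _ => Pm x)).
    assert (Q2 := derive_nonneg_le _ _ t s Hts (fun x _ => Dp x) (fun x _ => Pp x)).
    simpl in Q1, Q2. lra.
Qed.

Lemma is_derive_RInt_continuous :
  forall (f : R -> R) (s t : R), (forall x, continuous f x) ->
    is_derive (fun x => RInt f s x) t (f t).
Proof.
  intros f s t Hf.
  apply (is_derive_RInt f (fun x => RInt f s x) s t); [|apply Hf].
  apply filter_forall. intro x.
  apply (@RInt_correct R_CompleteNormedModule), ex_RInt_continuous.
  intros y _. apply Hf.
Qed.

Lemma is_derive_continuous :
  forall (f : R -> R) (t l : R), is_derive f t l -> continuous f t.
Proof. intros f t l H. apply (ex_derive_continuous f). now exists l. Qed.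

Lemma lipschitz_constant_ge_0 :
  forall (F : R -> R -> R) (L : R),
    (forall t x x', Rabs (F t x - F t x') <= L * Rabs (x - x')) -> 0 <= L.
Proof.
  intros F L HL. assert (H := HL 0 1 0). assert (H1 := Rabs_pos (F 0 1 - F 0 0)).
  replace (1 - 0) with 1 in H by ring. rewrite Rabs_R1 in H. lra.
Qed.

Lemma continuous_lipschitz_force :
  forall (F : R -> R -> R) (L : R),
    (forall x t, continuous (fun t => F t x) t) ->
    (forall t x x', Rabs (F t x - F t x') <= L * Rabs (x - x')) ->
    forall u : R -> R, (forall t, continuous u t) ->
    forall t, continuous (fun t => F t (u t)) t.
Proof.
  intros F L Hc HL u Hu t.
  apply filterlim_locally. intro eps.
  assert (HL0 := lipschitz_constant_ge_0 F L HL).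
  assert (He : 0 < eps / 2 / (L + 1)).
  { apply Rdiv_lt_0_compat; [|lra]. destruct eps; simpl; lra. }
  assert (He2 : 0 < eps / 2) by (destruct eps; simpl; lra).
  assert (H1 := proj1 (filterlim_locally _ _) (Hu t) (mkposreal _ He)).
  assert (H2 := proj1 (filterlim_locally _ _) (Hc (u t) t) (mkposreal _ He2)).
  generalize (filter_and _ _ H1 H2). apply filter_imp. intros x [B1 B2].
  change (Rabs (u x - u t) < eps / 2 / (L + 1)) in B1.
  change (Rabs (F x (u t) - F t (u t)) < eps / 2) in B2.
  change (Rabs (F x (u x) - F t (u t)) < eps).
  replace (F x (u x) - F t (u t))
    with ((F x (u x) - F x (u t)) + (F x (u t) - F t (u t))) by ring.
  eapply Rle_lt_trans; [apply Rabs_triang|].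
  assert (B3 := HL x (u x) (u t)).
  assert (B4 : (L + 1) * Rabs (u x - u t) < (L + 1) * (eps / 2 / (L + 1)))
    by (apply Rmult_lt_compat_l; lra).
  replace ((L + 1) * (eps / 2 / (L + 1))) with (eps / 2) in B4 by (field; lra).
  assert (B5 := Rabs_pos (u x - u t)). lra.
Qed.

(** The fixed points of this map are the solutions of [z'' = F(t, z)],
    [z(s) = z0], [z'(s) = p0]; writing the second order equation as one map on
    positions avoids iterating on pairs. *)
Definition picard (F : R -> R -> R) (s z0 p0 : R) (u : R -> R) (t : R) : R :=
  z0 + RInt (fun x => p0 + RInt (fun r => F r (u r)) s x) s t.


Lemma picard_derive :
  forall (F : R -> R -> R) (s z0 p0 : R) (u : R -> R),
    (forall t, continuous (fun t => F t (u t)) t) ->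
    forall t,
      is_derive (picard F s z0 p0 u) t (p0 + RInt (fun r => F r (u r)) s t) /\
      is_derive (fun t => p0 + RInt (fun r => F r (u r)) s t) t (F t (u t)).
Proof.
  intros F s z0 p0 u Hc.
  assert (Dp : forall t,
    is_derive (fun t => p0 + RInt (fun r => F r (u r)) s t) t (F t (u t))).
  { intro t. replace (F t (u t)) with (0 + F t (u t)) by ring.
    apply (is_derive_plus (fun _ => p0)); [apply @is_derive_const|].
    now apply (is_derive_RInt_continuous (fun r => F r (u r))). }
  intro t. split; [|apply Dp].
  unfold picard.
  replace (p0 + RInt (fun r => F r (u r)) s t)
    with (0 + (p0 + RInt (fun r => F r (u r)) s t)) by ring.
  apply (is_derive_plus (fun _ => z0)); [apply @is_derive_const|].
  apply (is_derive_RInt_continuous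
           (fun x => p0 + RInt (fun r => F r (u r)) s x)).
  intro x. eapply is_derive_continuous, Dp.
Qed.

(** Each of the two integrations gains a factor [1 / k], so the Lipschitz constant
    [L] is reduced to [L / k ^ 2]. *)
Lemma picard_contracts :
  forall (F : R -> R -> R) (L k s z0 p0 B : R) (u u' : R -> R),
    0 < k -> 2 * L <= k ^ 2 -> 0 <= B ->
    (forall t x x', Rabs (F t x - F t x') <= L * Rabs (x - x')) ->
    (forall t, continuous (fun t => F t (u t)) t) ->
    (forall t, continuous (fun t => F t (u' t)) t) ->
    (forall t, Rabs (u t - u' t) <= B * weight k s t) ->
    forall t, Rabs (picard F s z0 p0 u t - picard F s z0 p0 u' t)
              <= B / 2 * weight k s t.
Proof.
  intros F L k s z0 p0 B u u' Hk HLk HB HL Hu Hu' Huu t.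
  assert (HL0 := lipschitz_constant_ge_0 F L HL).
  set (q := fun x => p0 + RInt (fun r => F r (u r)) s x).
  set (q' := fun x => p0 + RInt (fun r => F r (u' r)) s x).
  assert (H1 : forall x, Rabs (q x - q' x) <= L * B / k * weight k s x).
  { apply (weight_bound (fun x => q x - q' x) (fun x => F x (u x) - F x (u' x)));
      [exact Hk| | |].
    - intro x. exact (is_derive_minus q q' x _ _
        (proj2 (picard_derive F s z0 p0 u Hu x))
        (proj2 (picard_derive F s z0 p0 u' Hu' x))).
    - unfold q, q'. rewrite !RInt_point. unfold zero; simpl. ring.
    - intro x. eapply Rle_trans; [apply HL|].
      rewrite Rmult_assoc. apply Rmult_le_compat_l; auto. }
  assert (H2 := weight_bound
     (fun x => picard F s z0 p0 u x - picard F s z0 p0 u' x)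
     (fun x => q x - q' x) k s (L * B / k) Hk).
  eapply Rle_trans.
  - apply H2; [| |exact H1].
    + intro x. exact (is_derive_minus (picard F s z0 p0 u) (picard F s z0 p0 u') x _ _
        (proj1 (picard_derive F s z0 p0 u Hu x))
        (proj1 (picard_derive F s z0 p0 u' Hu' x))).
    + unfold picard. rewrite !RInt_point. unfold zero; simpl. ring.
  - apply Rmult_le_compat_r; [assert (W := weight_ge_1 k s t); lra|].
    apply (Rmult_le_reg_r (k ^ 2)); [nra|].
    replace (L * B / k / k * k ^ 2) with (L * B) by (field; lra). nra.
Qed.

(** A geometric series in the weighted norm. The weight is bounded near each
    time, so the convergence is locally uniform and the limit continuous. *)
Lemma weighted_limit :
  forall (u : nat -> R -> R) (k s B : R), 0 <= B ->
    (forall n t, continuous (u n) t) ->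
    (forall n t, Rabs (u (S n) t - u n t) <= B / 2 ^ n * weight k s t) ->
    exists z : R -> R, (forall t, continuous z t) /\
      forall n t, Rabs (z t - u n t) <= 2 * B / 2 ^ n * weight k s t.
Proof.
  intros u k s B HB Hc Hstep.
  assert (Hp : forall n, 0 < 2 ^ n) by (intro; apply pow_lt; lra).
  assert (Htail : forall n m t,
    Rabs (u (n + m)%nat t - u n t) <= 2 * B / 2 ^ n * (1 - / 2 ^ m) * weight k s t).
  { intros n m t. induction m as [|m IH].
    - rewrite Nat.add_0_r. replace (u n t - u n t) with 0 by ring.
      rewrite Rabs_R0. simpl. rewrite Rinv_1. lra.
    - replace (n + S m)%nat with (S (n + m)) by lia.
      replace (u (S (n + m)) t - u n t)
        with ((u (S (n + m)) t - u (n + m)%nat t) + (u (n + m)%nat t - u n t)) by ring.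
      eapply Rle_trans; [apply Rabs_triang|].
      eapply Rle_trans; [apply Rplus_le_compat; [apply Hstep|apply IH]|].
      rewrite pow_add. simpl (2 ^ S m).
      apply Req_le. field. split; apply Rgt_not_eq, Hp. }
  assert (Htail' : forall n m t,
    Rabs (u (n + m)%nat t - u n t) <= 2 * B / 2 ^ n * weight k s t).
  { intros n m t. eapply Rle_trans; [apply Htail|].
    assert (W := weight_ge_1 k s t).
    assert (P1 : 0 <= 2 * B / 2 ^ n) by (apply Rdiv_le_0_compat; [lra|apply Hp]).
    assert (P2 : 0 < / 2 ^ m) by apply Rinv_0_lt_compat, Hp.
    apply Rmult_le_compat_r; [lra|]. nra. }
  assert (Hsmall : forall M eps : R, 0 < eps ->
     exists N : nat, M / 2 ^ N < eps).
  { intros M eps He.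
    destruct (Pow_x_infinity 2 ltac:(rewrite Rabs_pos_eq; lra) (M / eps + 1)) as [N HN].
    exists N. assert (H := HN N (Nat.le_refl N)).
    rewrite Rabs_pos_eq in H by (apply Rlt_le, Hp).
    apply (Rmult_lt_reg_r (2 ^ N)); [apply Hp|].
    unfold Rdiv. rewrite Rmult_assoc, Rinv_l, Rmult_1_r by apply Rgt_not_eq, Hp.
    assert (H2 : eps * (M / eps + 1) <= eps * 2 ^ N)
      by (apply Rmult_le_compat_l; lra).
    replace (eps * (M / eps + 1)) with (M + eps) in H2 by (field; lra). lra. }
  assert (Hcau : forall t, ex_finite_lim_seq (fun n => u n t)).
  { intro t. apply ex_lim_seq_cauchy_corr. intro eps.
    destruct (Hsmall (2 * B * weight k s t) (eps / 2)) as [N HN];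
      [destruct eps; simpl; lra|].
    exists N. intros n m Hn Hm.
    assert (Q1 := Htail' N (n - N)%nat t). assert (Q2 := Htail' N (m - N)%nat t).
    replace (N + (n - N))%nat with n in Q1 by lia.
    replace (N + (m - N))%nat with m in Q2 by lia.
    replace (2 * B / 2 ^ N * weight k s t)
      with (2 * B * weight k s t / 2 ^ N) in Q1, Q2
      by (field; apply Rgt_not_eq, Hp).
    replace (u n t - u m t) with ((u n t - u N t) - (u m t - u N t)) by ring.
    apply Rabs_le_between in Q1. apply Rabs_le_between in Q2.
    apply Rabs_lt_between. lra. }
  exists (fun t => real (Lim_seq (fun n => u n t))).
  assert (Hz : forall n t,
    Rabs (real (Lim_seq (fun n => u n t)) - u n t) <= 2 * B / 2 ^ n * weight k s t).
  { intros n t. assert (L := Lim_seq_correct' _ (Hcau t)).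
    set (l := real (Lim_seq (fun n => u n t))) in *.
    apply (is_lim_seq_incr_n _ n) in L.
    assert (L2 : is_lim_seq (fun m => Rabs (u (m + n)%nat t - u n t)) (Rabs (l - u n t))).
    { apply (is_lim_seq_abs _ (Finite (l - u n t))).
      apply is_lim_seq_minus'; [exact L|apply is_lim_seq_const]. }
    assert (L3 := is_lim_seq_le _ _ _ _
       (fun m => eq_ind _ (fun i => Rabs (u i t - u n t) <= _) (Htail' n m t) _
                   (Nat.add_comm n m)) L2 (is_lim_seq_const _)).
    exact L3. }
  split; [|exact Hz].
  intro t. apply filterlim_locally. intro eps.
  assert (Hw : continuous (weight k s) t).
  { apply (ex_derive_continuous (weight k s)). unfold weight. auto_derive. trivial. }
  destruct (Hsmall (2 * B * (weight k s t + 1)) (eps / 3)) as [N HN];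
    [destruct eps; simpl; lra|].
  assert (He3 : 0 < eps / 3) by (destruct eps; simpl; lra).
  assert (E1 := proj1 (filterlim_locally _ _) (Hc N t) (mkposreal _ He3)).
  assert (E2 := proj1 (filterlim_locally _ _) Hw (mkposreal 1 Rlt_0_1)).
  generalize (filter_and _ _ E1 E2). apply filter_imp. intros x [B1 B2].
  change (Rabs (u N x - u N t) < eps / 3) in B1.
  change (Rabs (weight k s x - weight k s t) < 1) in B2.
  set (z := fun t => real (Lim_seq (fun n => u n t))) in *.
  change (Rabs (z x - z t) < eps).
  assert (Z1 := Hz N x). assert (Z2 := Hz N t).
  fold (z x) in Z1. fold (z t) in Z2.
  assert (Q : 0 <= 2 * B / 2 ^ N) by (apply Rdiv_le_0_compat; [lra|apply Hp]).
  assert (Q2 : 2 * B / 2 ^ N * (weight k s t + 1) < eps / 3).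
  { replace (2 * B / 2 ^ N * (weight k s t + 1))
      with (2 * B * (weight k s t + 1) / 2 ^ N)
      by (field; apply Rgt_not_eq, Hp). exact HN. }
  apply Rabs_lt_between in B1. apply Rabs_lt_between in B2.
  apply Rabs_le_between in Z1. apply Rabs_le_between in Z2.
  apply Rabs_lt_between. split; nra.
Qed.

(** The force at [z0] has to be bounded in time for the first Picard step to be
    finite in the weighted norm; this is what makes the solution global. *)
Lemma picard_lindelof :
  forall (F : R -> R -> R) (L N s z0 p0 : R),
    (forall x t, continuous (fun t => F t x) t) ->
    (forall t x x', Rabs (F t x - F t x') <= L * Rabs (x - x')) ->
    (forall t, Rabs (F t z0) <= N) ->
    exists z p : R -> R, z s = z0 /\ p s = p0 /\
      forall t, is_derive z t (p t) /\ is_derive p t (F t (z t)).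
Proof.
  intros F L N s z0 p0 Hc HL HN.
  assert (HL0 := lipschitz_constant_ge_0 F L HL).
  assert (HN0 : 0 <= N) by (eapply Rle_trans; [apply Rabs_pos|apply (HN 0)]).
  (* Any [k] with [2 * L <= k ^ 2] makes the Picard map a contraction by 1/2. *)
  set (k := 1 + L).
  assert (Hk : 0 < k) by (unfold k; lra).
  assert (HLk : 2 * L <= k ^ 2) by (unfold k; nra).
  set (T := picard F s z0 p0).
  set (u := fun n => Nat.iter n T (fun _ => z0)).
  assert (Hcomp := continuous_lipschitz_force F L Hc HL).
  assert (HT : forall f, (forall t, continuous f t) -> forall t, continuous (T f) t).
  { intros f Hf t. eapply is_derive_continuous.
    apply (proj1 (picard_derive F s z0 p0 f (Hcomp f Hf) t)). }
  assert (Hu : forall n t, continuous (u n) t).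
  { induction n as [|n IH]; intro t; [apply continuous_const|].
    change (continuous (T (u n)) t). now apply HT. }
  set (B := (Rabs p0 + N / k) / k).
  assert (HB : 0 <= B).
  { unfold B. apply Rdiv_le_0_compat; [|exact Hk].
    apply Rplus_le_le_0_compat; [apply Rabs_pos|].
    now apply Rdiv_le_0_compat. }
  assert (H0 : forall t, Rabs (u 1%nat t - u 0%nat t) <= B * weight k s t).
  { set (q := fun x => RInt (fun r => F r z0) s x).
    assert (Hq : forall x, Rabs (q x) <= N / k * weight k s x).
    { apply (weight_bound q (fun x => F x z0)); [exact Hk| | |].
      - intro x. now apply (is_derive_RInt_continuous (fun r => F r z0)).
      - unfold q. rewrite RInt_point. reflexivity.
      - intro x. assert (W := weight_ge_1 k s x). specialize (HN x). nra. }
    apply (weight_bound (fun x => u 1%nat x - u 0%nat x) (fun x => p0 + q x));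
      [exact Hk| | |].
    - intro x. replace (p0 + q x) with ((p0 + q x) - 0) by ring.
      apply (is_derive_minus (u 1%nat) (u 0%nat)); [|apply @is_derive_const].
      apply (picard_derive F s z0 p0 (fun _ => z0)). intro; apply Hc.
    - unfold u; simpl. unfold T, picard. rewrite RInt_point. unfold zero; simpl. ring.
    - intro x. eapply Rle_trans; [apply Rabs_triang|].
      assert (W := weight_ge_1 k s x). specialize (Hq x).
      assert (P := Rabs_pos p0). nra. }
  assert (Hstep : forall n t, Rabs (u (S n) t - u n t) <= B / 2 ^ n * weight k s t).
  { induction n as [|n IH]; intro t.
    - simpl (2 ^ 0). rewrite Rdiv_1_r. apply H0.
    - replace (B / 2 ^ S n) with (B / 2 ^ n / 2)
        by (simpl; field; apply pow_nonzero; lra).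
      apply (picard_contracts F L k s z0 p0 (B / 2 ^ n) (u (S n)) (u n)); auto.
      apply Rdiv_le_0_compat; [exact HB|apply pow_lt; lra]. }
  destruct (weighted_limit u k s B HB Hu Hstep) as [z [Hz Hlim]].
  assert (Hfix : forall t, T z t = z t).
  { intro t. apply cond_eq. intros eps He.
    assert (W := weight_ge_1 k s t).
    destruct (Pow_x_infinity 2 ltac:(rewrite Rabs_pos_eq; lra)
                (2 * B * weight k s t / eps + 1)) as [n Hn].
    assert (P : 0 < 2 ^ n) by (apply pow_lt; lra).
    specialize (Hn n (Nat.le_refl n)). rewrite Rabs_pos_eq in Hn by lra.
    assert (Q1 := picard_contracts F L k s z0 p0 (2 * B / 2 ^ n) z (u n) Hk HLk
       ltac:(apply Rdiv_le_0_compat; lra) HL (Hcomp z Hz) (Hcomp _ (Hu n)) (Hlim n) t).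
    assert (Q2 := Hlim (S n) t).
    change (picard F s z0 p0 z t) with (T z t) in Q1.
    change (picard F s z0 p0 (u n) t) with (u (S n) t) in Q1.
    replace (2 * B / 2 ^ S n) with (2 * B / 2 ^ n / 2) in Q2
      by (simpl; field; lra).
    assert (Q3 : 2 * B / 2 ^ n * weight k s t < eps).
    { apply (Rmult_lt_reg_r (2 ^ n)); [exact P|].
      replace (2 * B / 2 ^ n * weight k s t * 2 ^ n) with (2 * B * weight k s t)
        by (field; lra).
      assert (H2 : eps * (2 * B * weight k s t / eps + 1) <= eps * 2 ^ n)
        by (apply Rmult_le_compat_l; lra).
      replace (eps * (2 * B * weight k s t / eps + 1))
        with (2 * B * weight k s t + eps) in H2 by (field; lra). lra. }
    apply Rabs_le_between in Q1. apply Rabs_le_between in Q2.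
    apply Rabs_lt_between. lra. }
  assert (D := picard_derive F s z0 p0 z (Hcomp z Hz)).
  exists z, (fun t => p0 + RInt (fun r => F r (z r)) s t).
  split; [|split].
  - rewrite <- Hfix. unfold T, picard. rewrite RInt_point. unfold zero; simpl. ring.
  - rewrite RInt_point. unfold zero; simpl. ring.
  - intro t. destruct (D t) as [D1 D2]. split; [|exact D2].
    now apply (is_derive_ext (T z)).
Qed.

(** * The autonomous equation *)

(** The conservative equation [y'' + K y + y^2 = 0] run at the time-dependent speed
    [beta]; the orbits in the [(y, v)]-plane do not depend on [beta]. *)
Definition rescaled_flow (K : R) (beta : R -> R) (s : R) (b : Rbar)
  (y v : R -> R) : Prop :=
  forall t, s <= t -> Rbar_lt t b ->
    is_derive y t (beta t * v t) /\
    is_derive v t (- beta t * (K * y t + y t ^ 2)).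

Definition potential (K y : R) : R := K * y ^ 2 / 2 + y ^ 3 / 3.

(** The level of the saddle [y = - K] is [K ^ 3 / 6]. The factorization shows that
    this level is reached again at [y = K / 2] and nowhere else, so the well is
    the interval from [- K] to [K / 2]. *)
Lemma potential_saddle :
  forall K y, potential K y - K ^ 3 / 6 = (y + K) ^ 2 * (y - K / 2) / 3.
Proof. intros K y. unfold potential. field. Qed.

Lemma potential_le :
  forall K y0 y, 0 < K -> K / 2 <= y0 -> y <= y0 -> potential K y <= potential K y0.
Proof.
  intros K y0 y HK H0 Hy.
  destruct (Rle_dec (K / 2) y) as [H|H].
  - unfold potential.
    assert (0 <= y ^ 2 + y * y0 + y0 ^ 2) by nra.
    assert (0 <= (y0 - y) * (y0 ^ 2 + y * y0 + y ^ 2)) by (apply Rmult_le_pos; lra).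
    assert (0 <= K * ((y0 - y) * (y0 + y)))
      by (apply Rmult_le_pos; [|apply Rmult_le_pos]; lra). lra.
  - assert (H1 := potential_saddle K y). assert (H2 := potential_saddle K y0).
    assert (0 <= (y + K) ^ 2) by apply pow2_ge_0.
    assert (0 <= (y0 + K) ^ 2) by apply pow2_ge_0.
    assert (0 <= (y0 + K) ^ 2 * (y0 - K / 2)) by (apply Rmult_le_pos; lra).
    assert (0 <= (y + K) ^ 2 * (K / 2 - y)) by (apply Rmult_le_pos; lra). lra.
Qed.

Lemma potential_lt_saddle :
  forall K y0, 0 < K -> K / 2 < y0 -> K ^ 3 / 6 < potential K y0.
Proof.
  intros K y0 HK H. assert (E := potential_saddle K y0).
  assert (0 < (y0 + K) ^ 2) by (apply pow_lt; lra).
  assert (0 < (y0 + K) ^ 2 * (y0 - K / 2)) by (apply Rmult_lt_0_compat; lra). lra.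
Qed.

Lemma Rbar_le_lt_trans_R :
  forall (x t : R) (b : Rbar), x <= t -> Rbar_lt t b -> Rbar_lt x b.
Proof. intros x t b H H'. now apply (Rbar_le_lt_trans x t b). Qed.

Lemma energy_conserved :
  forall K beta s b y v, rescaled_flow K beta s b y v ->
    forall t, s <= t -> Rbar_lt t b ->
      v t ^ 2 / 2 + potential K (y t) = v s ^ 2 / 2 + potential K (y s).
Proof.
  intros K beta s b y v Hf t Hst Htb.
  assert (D : forall x, s <= x <= t ->
    is_derive (fun x => v x ^ 2 / 2 + potential K (y x)) x 0).
  { intros x [H1 H2].
    destruct (Hf x H1 (Rbar_le_lt_trans_R _ _ _ H2 Htb)) as [Dy Dv].
    unfold potential. auto_derive.
    - repeat split; eexists; eassumption.
    - replace (Derive (fun x => y x) x) with (beta x * v x)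
        by (symmetry; now apply is_derive_unique).
      replace (Derive (fun x => v x) x) with (- beta x * (K * y x + y x ^ 2))
        by (symmetry; now apply is_derive_unique).
      field. }
  assert (D' : forall x, s <= x <= t ->
    is_derive (fun x => - (v x ^ 2 / 2 + potential K (y x))) x 0).
  { intros x Hx. replace 0 with (- 0) by ring.
    apply (is_derive_opp (fun x => v x ^ 2 / 2 + potential K (y x))). now apply D. }
  apply Rle_antisym.
  - assert (H := derive_nonneg_le _ _ s t Hst D' (fun _ _ => Rle_refl 0)).
    simpl in H |- *. lra.
  - exact (derive_nonneg_le _ _ s t Hst D (fun _ _ => Rle_refl 0)).
Qed.

(** The energy of the saddle equals that of its separatrices, so conservation of
    energy alone does not keep the motion there: uniqueness is needed. On a
    compact time interval [y] is bounded, and Gronwall applies to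
    [(y + K)^2 + v^2]. *)
Lemma equilibrium_stays :
  forall K beta beta1 s b y v, rescaled_flow K beta s b y v ->
    (forall t, 0 < beta t <= beta1) ->
    y s = - K -> v s = 0 ->
    forall t, s <= t -> Rbar_lt t b -> y t = - K.
Proof.
  intros K beta beta1 s b y v Hf Hb Hy Hv t Hst Htb.
  assert (Hf' : forall x, s <= x <= t ->
    is_derive y x (beta x * v x) /\ is_derive v x (- beta x * (K * y x + y x ^ 2))).
  { intros x [H1 H2]. apply Hf; [exact H1|]. now apply (Rbar_le_lt_trans_R x t). }
  assert (Hbd : exists N, forall x, s <= x <= t -> Rabs (1 - y x) <= N).
  { destruct (continuity_ab_maj (fun x => Rabs (1 - y x)) s t Hst) as [m [Hm _]].
    - intros x Hx. apply continuity_pt_filterlim.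
      apply (continuous_comp (fun x => 1 - y x) Rabs); [|apply continuous_Rabs].
      apply (continuous_minus (fun _ => 1) y); [apply continuous_const|].
      exact (is_derive_continuous y x _ (proj1 (Hf' x Hx))).
    - exists (Rabs (1 - y m)). exact Hm. }
  destruct Hbd as [N HN].
  set (u := fun x => (y x + K) ^ 2 + v x ^ 2).
  assert (Hu : u t = 0).
  { apply (gronwall_zero u
      (fun x => 2 * beta x * ((y x + K) * v x * (1 - y x))) (beta1 * N) s t Hst).
    - intros x Hx. destruct (Hf' x Hx) as [Dy Dv]. unfold u. auto_derive.
      + repeat split; eexists; eassumption.
      + replace (Derive (fun x => y x) x) with (beta x * v x)
          by (symmetry; now apply is_derive_unique).
        replace (Derive (fun x => v x) x) with (- beta x * (K * y x + y x ^ 2))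
          by (symmetry; now apply is_derive_unique).
        ring.
    - intros x _. apply Rplus_le_le_0_compat; apply pow2_ge_0.
    - intros x Hx. unfold u.
      set (w := y x + K). set (d := v x). set (S := w ^ 2 + d ^ 2).
      assert (HS : 2 * Rabs (w * d) <= S).
      { unfold S. rewrite Rabs_mult, <- (pow2_abs w), <- (pow2_abs d).
        assert (Q := pow2_ge_0 (Rabs w - Rabs d)). nra. }
      assert (H1 : 2 * (w * d * (1 - y x)) <= S * N).
      { eapply Rle_trans.
        - apply Rmult_le_compat_l; [lra|apply Rle_abs].
        - rewrite Rabs_mult, <- Rmult_assoc.
          apply Rmult_le_compat; auto; try apply Rabs_pos.
          assert (Q := Rabs_pos (w * d)). lra. }
      assert (HN0 : 0 <= N) by (eapply Rle_trans; [apply Rabs_pos|apply (HN x Hx)]).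
      assert (HSN : 0 <= S * N).
      { apply Rmult_le_pos; [|exact HN0].
        apply Rplus_le_le_0_compat; apply pow2_ge_0. }
      destruct (Hb x) as [b0 b1]. nra.
    - unfold u. rewrite Hy, Hv. ring. }
  unfold u in Hu.
  rewrite <- !Rsqr_pow2 in Hu. apply Rplus_sqr_eq_0_l in Hu. lra.
Qed.

(** Below the saddle level the motion cannot meet [y = - K], hence stays to its
    right, where the energy also forbids [y > K / 2]. The lower end point of the
    well is the equilibrium itself. *)
Lemma trapped_in_well :
  forall K beta beta1 s b y v, 0 < K -> rescaled_flow K beta s b y v ->
    (forall t, 0 < beta t <= beta1) ->
    v s = 0 -> - K <= y s < K / 2 ->
    forall t, s <= t -> Rbar_lt t b -> - K <= y t <= K / 2 /\ v t ^ 2 <= K ^ 3.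
Proof.
  intros K beta beta1 s b y v HK Hf Hb Hv [Hy1 Hy2].
  assert (Hy : forall t, s <= t -> Rbar_lt t b -> - K <= y t <= K / 2).
  { destruct (Req_dec (y s) (- K)) as [Heq|Hne].
    { intros t Hst Htb.
      rewrite (equilibrium_stays K beta beta1 s b y v Hf Hb Heq Hv t Hst Htb). lra. }
    assert (Hlow : potential K (y s) < K ^ 3 / 6).
    { assert (E := potential_saddle K (y s)).
      assert (0 < (y s + K) ^ 2) by (apply pow_lt; lra).
      assert (0 < (y s + K) ^ 2 * (K / 2 - y s)) by (apply Rmult_lt_0_compat; lra).
      lra. }
    assert (Hbelow : forall t, s <= t -> Rbar_lt t b -> potential K (y t) < K ^ 3 / 6).
    { intros t Hst Htb.
      assert (E := energy_conserved K beta s b y v Hf t Hst Htb).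
      rewrite Hv in E. assert (Q := pow2_ge_0 (v t)). lra. }
    assert (Hneq : forall t, s <= t -> Rbar_lt t b -> y t <> - K).
    { intros t Hst Htb Hyt. assert (Q := Hbelow t Hst Htb).
      rewrite Hyt in Q. unfold potential in Q. lra. }
    intros t Hst Htb.
    assert (Hgt : - K < y t).
    { apply Rnot_le_lt. intro Hle.
      assert (H1 : y t < - K).
      { assert (Q := Hneq t Hst Htb). lra. }
      assert (Hlt : s < t).
      { destruct Hst as [H|H]; [exact H|subst t; lra]. }
      destruct (IVT_interv (fun x => - K - y x) s t) as [c [Hc Hc0]].
      - intros x [Hx1 Hx2]. apply continuity_pt_filterlim.
        apply (continuous_minus (fun _ => - K) y); [apply continuous_const|].
        apply (is_derive_continuous y x (beta x * v x)).
        apply Hf; [exact Hx1|]. now apply (Rbar_le_lt_trans_R x t).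
      - exact Hlt.
      - lra.
      - lra.
      - apply (Hneq c); [lra| |lra]. apply (Rbar_le_lt_trans_R c t); [lra|exact Htb]. }
    split; [lra|].
    assert (Q := Hbelow t Hst Htb). assert (E := potential_saddle K (y t)).
    assert (P : 0 < (y t + K) ^ 2) by (apply pow_lt; lra).
    apply Rnot_lt_le. intro Hc.
    assert (0 < (y t + K) ^ 2 * (y t - K / 2)) by (apply Rmult_lt_0_compat; lra).
    lra. }
  intros t Hst Htb. split; [now apply Hy|].
  assert (E := energy_conserved K beta s b y v Hf t Hst Htb).
  rewrite Hv in E.
  assert (E0 := potential_saddle K (y s)).
  assert (P0 : 0 <= (y s + K) ^ 2 * (K / 2 - y s))
    by (apply Rmult_le_pos; [apply pow2_ge_0|lra]).
  destruct (Hy t Hst Htb) as [Y1 Y2].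
  assert (L : - (K ^ 3) / 3 <= potential K (y t)).
  { unfold potential.
    assert (0 <= (y t + K) * (y t ^ 2 - K * y t + K ^ 2))
      by (apply Rmult_le_pos; nra).
    assert (0 <= K * y t ^ 2) by (apply Rmult_le_pos; [lra|apply pow2_ge_0]).
    lra. }
  lra.
Qed.

(** Above the saddle level a bounded motion is excluded by the Lyapunov function
    [W = - v exp (- lam y)]. Up to the factor [beta exp (- lam y)] its derivative
    is [K y + y^2 + lam v^2]. The force term is at least [- K^2 / 4], and positive
    for [y >= K / 2]; for [y <= K / 2] the energy excess [delta] over the saddle
    gives [v^2 >= 2 delta], so a large [lam] makes the sum at least [K^2 / 4]
    everywhere. Along a bounded motion [W] would be bounded and yet grow
    linearly. *)
Lemma supercritical_unbounded :
  forall K beta beta0 s y v N, 0 < K -> 0 < beta0 ->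
    rescaled_flow K beta s p_infty y v ->
    (forall t, beta0 <= beta t) ->
    K ^ 3 / 6 < v s ^ 2 / 2 + potential K (y s) ->
    ~ (forall t, s <= t -> Rabs (y t) <= N /\ Rabs (v t) <= N).
Proof.
  intros K beta beta0 s y v N HK Hb0 Hf Hb HE Hbd.
  set (E := v s ^ 2 / 2 + potential K (y s)) in *.
  set (delta := E - K ^ 3 / 6).
  assert (Hdelta : 0 < delta) by (unfold delta; lra).
  (* Chosen so that [lam * (2 * delta)] is twice the depth [K^2 / 4] of the force. *)
  set (lam := K ^ 2 / (4 * delta)).
  assert (Hlam : 0 < lam).
  { unfold lam. apply Rdiv_lt_0_compat; [apply pow_lt|]; lra. }
  assert (Hgrow : forall t, s <= t ->
    K ^ 2 / 4 <= K * y t + y t ^ 2 + lam * v t ^ 2).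
  { intros t Ht.
    assert (C := energy_conserved K beta s p_infty y v Hf t Ht I). fold E in C.
    assert (S := potential_saddle K (y t)).
    destruct (Rle_dec (K / 2) (y t)) as [H|H].
    - assert (0 <= lam * v t ^ 2) by (apply Rmult_le_pos; [lra|apply pow2_ge_0]). nra.
    - assert (P : 0 <= (y t + K) ^ 2 * (K / 2 - y t))
        by (apply Rmult_le_pos; [apply pow2_ge_0|lra]).
      assert (V : 2 * delta <= v t ^ 2) by (unfold delta; lra).
      assert (L : lam * (2 * delta) <= lam * v t ^ 2)
        by (apply Rmult_le_compat_l; lra).
      replace (lam * (2 * delta)) with (K ^ 2 / 2) in L by (unfold lam; field; lra).
      assert (Q := pow2_ge_0 (y t + K / 2)). nra. }
  assert (HN : 0 <= N).
  { eapply Rle_trans; [apply Rabs_pos|]. apply (Hbd s). lra. }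
  set (c := beta0 * (exp (- (lam * N)) * (K ^ 2 / 4))).
  assert (Hc : 0 < c).
  { unfold c. apply Rmult_lt_0_compat; [lra|].
    apply Rmult_lt_0_compat; [apply exp_pos|]. nra. }
  set (W := fun t => - v t * exp (- (lam * y t))).
  set (M := N * exp (lam * N)).
  assert (HW : forall t, s <= t -> Rabs (W t) <= M).
  { intros t Ht. destruct (Hbd t Ht) as [Hy Hv]. unfold W, M.
    rewrite Rabs_mult, Rabs_Ropp, (Rabs_pos_eq (exp _)) by apply Rlt_le, exp_pos.
    apply Rmult_le_compat; [apply Rabs_pos|apply Rlt_le, exp_pos|exact Hv|].
    apply Rabs_le_between in Hy.
    destruct (Rle_lt_or_eq_dec (- (lam * y t)) (lam * N)) as [Q|Q].
    - nra.
    - now apply Rlt_le, exp_increasing.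
    - rewrite Q. lra. }
  (* By then [W] has grown by more than the width of its range. *)
  set (T := s + (2 * M + 1) / c).
  assert (HM : 0 <= M) by (eapply Rle_trans; [apply Rabs_pos|apply (HW s); lra]).
  assert (HT : s <= T).
  { unfold T. assert (0 < (2 * M + 1) / c) by (apply Rdiv_lt_0_compat; lra). lra. }
  assert (Hmon : W s - c * s <= W T - c * T).
  { apply (derive_nonneg_le (fun t => W t - c * t)
      (fun t => beta t * (exp (- (lam * y t)) * (K * y t + y t ^ 2 + lam * v t ^ 2)) - c)
      s T HT).
    - intros x [Hx _]. destruct (Hf x Hx I) as [Dy Dv]. unfold W. auto_derive.
      + repeat split; eexists; eassumption.
      + replace (Derive (fun x => y x) x) with (beta x * v x)
          by (symmetry; now apply is_derive_unique).
        replace (Derive (fun x => v x) x) with (- beta x * (K * y x + y x ^ 2))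
          by (symmetry; now apply is_derive_unique).
        ring.
    - intros x [Hx _]. assert (G := Hgrow x Hx). destruct (Hbd x Hx) as [Hy _].
      apply Rabs_le_between in Hy.
      assert (X : exp (- (lam * N)) <= exp (- (lam * y x))).
      { destruct (Rle_lt_or_eq_dec (- (lam * N)) (- (lam * y x))) as [Q|Q].
        - nra.
        - now apply Rlt_le, exp_increasing.
        - rewrite Q. lra. }
      assert (X0 := exp_pos (- (lam * N))).
      assert (Y : exp (- (lam * N)) * (K ^ 2 / 4)
        <= exp (- (lam * y x)) * (K * y x + y x ^ 2 + lam * v x ^ 2))
        by (apply Rmult_le_compat; nra).
      unfold c.
      assert (Z : beta0 * (exp (- (lam * N)) * (K ^ 2 / 4))
        <= beta x * (exp (- (lam * y x)) * (K * y x + y x ^ 2 + lam * v x ^ 2))).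
      { apply Rmult_le_compat; [lra| |apply Hb|exact Y].
        apply Rmult_le_pos; [lra|nra]. }
      lra. }
  assert (W1 := HW s ltac:(lra)). assert (W2 := HW T HT).
  apply Rabs_le_between in W1. apply Rabs_le_between in W2.
  assert (X : c * T - c * s = 2 * M + 1) by (unfold T; field; lra).
  lra.
Qed.

(** * Reduction to the autonomous equation *)

Definition dalpha (omega B C t : R) : R :=
  2 * omega * (C * cos (2 * omega * t) - B * sin (2 * omega * t)).

Lemma amplitude_ge_0 : forall B C, 0 <= amplitude B C.
Proof. intros B C. apply sqrt_pos. Qed.

Lemma amplitude_sqr : forall B C, amplitude B C ^ 2 = B ^ 2 + C ^ 2.
Proof.
  intros B C. unfold amplitude. apply pow2_sqrt.
  apply Rplus_le_le_0_compat; apply pow2_ge_0.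
Qed.

Lemma is_derive_alpha :
  forall omega A B C t,
    is_derive (alpha omega A B C) t (dalpha omega B C t).
Proof.
  intros omega A B C t. unfold alpha, dalpha. auto_derive; [trivial|]. ring.
Qed.

Lemma is_derive_dalpha :
  forall omega A B C t,
    is_derive (dalpha omega B C) t (4 * omega ^ 2 * (A - alpha omega A B C t)).
Proof.
  intros omega A B C t. unfold alpha, dalpha. auto_derive; [trivial|]. ring.
Qed.

(** [alpha - A] and [dalpha / (2 omega)] are the two coordinates of a uniform
    rotation on the circle of radius [amplitude B C]. *)
Lemma dalpha_sqr :
  forall omega A B C t,
    dalpha omega B C t ^ 2
    = 4 * omega ^ 2 * (amplitude B C ^ 2 - (alpha omega A B C t - A) ^ 2).
Proof.
  intros omega A B C t. rewrite amplitude_sqr. unfold alpha, dalpha.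
  set (c := cos (2 * omega * t)). set (d := sin (2 * omega * t)).
  assert (H : c ^ 2 = 1 - d ^ 2).
  { assert (Q := sin2_cos2 (2 * omega * t)). fold c d in Q.
    unfold Rsqr in Q. lra. }
  ring [H].
Qed.

Lemma alpha_bounds :
  forall omega A B C t, 0 < omega ->
    A - amplitude B C <= alpha omega A B C t <= A + amplitude B C.
Proof.
  intros omega A B C t Ho.
  assert (H := dalpha_sqr omega A B C t).
  assert (H1 := pow2_ge_0 (dalpha omega B C t)).
  assert (H2 := amplitude_ge_0 B C).
  set (x := alpha omega A B C t - A) in *.
  assert (H3 : x ^ 2 <= amplitude B C ^ 2).
  { assert (0 < 4 * omega ^ 2) by nra. nra. }
  assert (H4 : Rabs x <= Rabs (amplitude B C)).
  { apply Rsqr_le_abs_0. unfold Rsqr. nra. }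
  rewrite (Rabs_pos_eq (amplitude B C)) in H4 by exact H2.
  apply Rabs_le_between in H4. unfold x in H4. lra.
Qed.

Lemma Rpower_three_halves :
  forall x, 0 < x -> Rpower x (3 / 2) = x * sqrt x.
Proof.
  intros x Hx. replace (3 / 2) with (1 + / 2) by field.
  rewrite Rpower_plus, Rpower_1, Rpower_sqrt by exact Hx. reflexivity.
Qed.

(** With [sqrt (alpha)] as the only irrational quantity, the change of variables
    is checked by field arithmetic. *)
Lemma g_sqrt :
  forall omega A B C t, 0 < alpha omega A B C t ->
    g omega A B C t = / sqrt (alpha omega A B C t) ^ 5.
Proof.
  intros omega A B C t H. unfold g. set (x := alpha omega A B C t) in *.
  rewrite Rpower_Ropp. f_equal.
  replace (5 / 2) with (1 + 1 + / 2) by field.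
  rewrite !Rpower_plus, Rpower_1, Rpower_sqrt by exact H.
  rewrite <- (sqrt_sqrt x) at 1 2 by lra. ring.
Qed.

Definition rescaled_position (omega A B C : R) (z : R -> R) (t : R) : R :=
  z t / sqrt (alpha omega A B C t).

(** The derivative of [rescaled_position] with respect to the new time [tau],
    where [dtau = dt / alpha]. *)
Definition rescaled_momentum (omega A B C : R) (z p : R -> R) (t : R) : R :=
  sqrt (alpha omega A B C t) * p t
  - dalpha omega B C t * z t / (2 * sqrt (alpha omega A B C t)).

Definition stiffness (omega A Rad : R) : R := omega ^ 2 * (A ^ 2 - Rad ^ 2).

(** The power [- 5 / 2] in [g] is the one for which the quadratic term becomes
    autonomous. The linear coefficient is autonomous because [alpha] oscillates at
    the frequency [2 omega]: it is
    [2 omega^2 A alpha - omega^2 alpha^2 - dalpha^2 / 4], which by [dalpha_sqr]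
    is the constant [stiffness]. *)
Lemma motion_rescaled_flow :
  forall omega A B C s z0 (a b : Rbar) z p,
    0 < omega -> amplitude B C < A ->
    motion omega A B C s z0 a b z p ->
    rescaled_flow (stiffness omega A (amplitude B C))
      (fun t => / alpha omega A B C t) s b
      (rescaled_position omega A B C z) (rescaled_momentum omega A B C z p).
Proof.
  intros omega A B C s z0 a b z p Ho HA [Has [Hsb [_ [_ Hm]]]] t Hst Htb.
  assert (Hat : Rbar_lt a t) by now apply (Rbar_lt_le_trans a s t).
  destruct (Hm t Hat Htb) as [Dz Dp]. clear Hm.
  assert (Hal : 0 < alpha omega A B C t)
    by (assert (Q := alpha_bounds omega A B C t Ho); lra).
  rewrite (g_sqrt omega A B C t Hal) in Dp.
  assert (Da := is_derive_alpha omega A B C t).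
  assert (Dd := is_derive_dalpha omega A B C t).
  assert (Hd := dalpha_sqr omega A B C t).
  assert (Hr := sqrt_lt_R0 _ Hal).
  assert (Hrr := sqrt_sqrt _ (Rlt_le _ _ Hal)).
  unfold rescaled_position, rescaled_momentum.
  split.
  - auto_derive.
    + repeat split; try (eexists; eassumption); try assumption. lra.
    + replace (Derive (fun x => z x) t) with (p t)
        by (symmetry; now apply is_derive_unique).
      replace (Derive (fun x => alpha omega A B C x) t) with (dalpha omega B C t)
        by (symmetry; now apply is_derive_unique).
      set (r := sqrt (alpha omega A B C t)) in *. rewrite <- Hrr.
      field. lra.
  - auto_derive.
    + repeat split; try (eexists; eassumption); try assumption. lra.
    + replace (Derive (fun x => z x) t) with (p t)
        by (symmetry; now apply is_derive_unique).
      replace (Derive (fun x => p x) t)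
        with (- (omega ^ 2 * z t + / sqrt (alpha omega A B C t) ^ 5 * z t ^ 2))
        by (symmetry; now apply is_derive_unique).
      replace (Derive (fun x => alpha omega A B C x) t) with (dalpha omega B C t)
        by (symmetry; now apply is_derive_unique).
      replace (Derive (fun x => dalpha omega B C x) t)
        with (4 * omega ^ 2 * (A - alpha omega A B C t))
        by (symmetry; now apply is_derive_unique).
      unfold stiffness.
      set (r := sqrt (alpha omega A B C t)) in *.
      set (d := dalpha omega B C t) in *.
      rewrite <- Hrr in Hd |- *.
      (* Eliminating the amplitude leaves an identity between rational functions. *)
      assert (HR : omega ^ 2 * amplitude B C ^ 2
        = d ^ 2 / 4 + omega ^ 2 * (r * r - A) ^ 2) by lra.
      rewrite (Rmult_minus_distr_l (omega ^ 2)), HR. field. lra.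
Qed.

(** * Continuation of bounded motions *)

Lemma lipschitz_uniqueness :
  forall (F : R -> R -> R) (L s T : R) (z p z' p' : R -> R), s <= T ->
    (forall t x x', Rabs (F t x - F t x') <= L * Rabs (x - x')) ->
    (forall t, s <= t <= T -> is_derive z t (p t) /\ is_derive p t (F t (z t))) ->
    (forall t, s <= t <= T -> is_derive z' t (p' t) /\ is_derive p' t (F t (z' t))) ->
    z s = z' s -> p s = p' s ->
    z T = z' T.
Proof.
  intros F L s T z p z' p' HsT HL H H' Hz Hp.
  set (u := fun x => (z x - z' x) ^ 2 + (p x - p' x) ^ 2).
  assert (Hu : u T = 0).
  { apply (gronwall_zero u
      (fun x => 2 * ((z x - z' x) * (p x - p' x))
                + 2 * ((p x - p' x) * (F x (z x) - F x (z' x)))) (1 + L) s T HsT).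
    - intros x Hx. destruct (H x Hx) as [D1 D2]. destruct (H' x Hx) as [D3 D4].
      unfold u. auto_derive.
      + repeat split; eexists; eassumption.
      + replace (Derive (fun x => z x) x) with (p x)
          by (symmetry; now apply is_derive_unique).
        replace (Derive (fun x => z' x) x) with (p' x)
          by (symmetry; now apply is_derive_unique).
        replace (Derive (fun x => p x) x) with (F x (z x))
          by (symmetry; now apply is_derive_unique).
        replace (Derive (fun x => p' x) x) with (F x (z' x))
          by (symmetry; now apply is_derive_unique).
        ring.
    - intros x _. apply Rplus_le_le_0_compat; apply pow2_ge_0.
    - intros x _. unfold u.
      assert (HF := HL x (z x) (z' x)).
      set (e := z x - z' x) in *. set (d := p x - p' x) in *.
      set (f := F x (z x) - F x (z' x)) in *.
      assert (HL0 := lipschitz_constant_ge_0 F L HL).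
      assert (Q1 : e * d <= Rabs e * Rabs d) by (rewrite <- Rabs_mult; apply Rle_abs).
      assert (Q2 : d * f <= Rabs d * (L * Rabs e)).
      { eapply Rle_trans; [apply Rle_abs|]. rewrite Rabs_mult.
        apply Rmult_le_compat_l; [apply Rabs_pos|exact HF]. }
      rewrite <- (pow2_abs e), <- (pow2_abs d).
      assert (Q3 := pow2_ge_0 (Rabs e - Rabs d)).
      assert (Q4 : 0 <= L * (Rabs e - Rabs d) ^ 2) by now apply Rmult_le_pos.
      lra.
    - unfold u. rewrite Hz, Hp. ring. }
  unfold u in Hu.
  rewrite <- !Rsqr_pow2 in Hu. apply Rplus_sqr_eq_0_l in Hu. lra.
Qed.

(** Cutting off the quadratic term makes the force globally Lipschitz without
    changing it on the region of interest. *)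
Definition clamp (M x : R) : R := Rmax (- M) (Rmin M x).

Lemma clamp_bounds : forall M x, 0 <= M -> - M <= clamp M x <= M.
Proof.
  intros M x HM. unfold clamp, Rmax, Rmin.
  repeat destruct Rle_dec; lra.
Qed.

Lemma clamp_id : forall M x, Rabs x <= M -> clamp M x = x.
Proof.
  intros M x H. apply Rabs_le_between in H. unfold clamp, Rmax, Rmin.
  repeat destruct Rle_dec; lra.
Qed.

Lemma clamp_sqr_lipschitz : forall M x y, 0 <= M ->
  Rabs (clamp M x ^ 2 - clamp M y ^ 2) <= 2 * M * Rabs (x - y).
Proof.
  intros M x y HM.
  assert (H : Rabs (clamp M x - clamp M y) <= Rabs (x - y)).
  { unfold clamp, Rmax, Rmin, Rabs.
    repeat destruct Rle_dec; repeat destruct Rcase_abs; lra. }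
  replace (clamp M x ^ 2 - clamp M y ^ 2)
    with ((clamp M x + clamp M y) * (clamp M x - clamp M y)) by ring.
  rewrite Rabs_mult. apply Rmult_le_compat; try apply Rabs_pos; [|exact H].
  assert (Hx := clamp_bounds M x HM). assert (Hy := clamp_bounds M y HM).
  apply Rabs_le. lra.
Qed.

Definition clamped_force (omega A B C M t x : R) : R :=
  - (omega ^ 2 * x + g omega A B C t * clamp M x ^ 2).

Lemma g_bounds :
  forall omega A B C t, 0 < omega -> amplitude B C < A ->
    0 <= g omega A B C t <= / Rpower (A - amplitude B C) (5 / 2).
Proof.
  intros omega A B C t Ho HA. unfold g. split.
  - unfold Rpower. apply Rlt_le, exp_pos.
  - rewrite Rpower_Ropp. apply Rinv_le_contravar.
    + unfold Rpower. apply exp_pos.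
    + apply Rle_Rpower_l; [lra|].
      assert (Q := alpha_bounds omega A B C t Ho). lra.
Qed.

Lemma clamped_motion_exists :
  forall omega A B C M s z0,
    0 < omega -> amplitude B C < A -> 0 <= M ->
    exists (L : R) (z p : R -> R),
      (forall t x x', Rabs (clamped_force omega A B C M t x
                            - clamped_force omega A B C M t x') <= L * Rabs (x - x')) /\
      z s = z0 /\ p s = 0 /\
      forall t, is_derive z t (p t) /\
                is_derive p t (clamped_force omega A B C M t (z t)).
Proof.
  intros omega A B C M s z0 Ho HA HM.
  set (G := / Rpower (A - amplitude B C) (5 / 2)).
  assert (Hg : forall t, 0 <= g omega A B C t <= G) by (intro t; now apply g_bounds).
  assert (Hw : 0 <= omega ^ 2) by apply pow2_ge_0.
  assert (HL : forall t x x', Rabs (clamped_force omega A B C M t x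
      - clamped_force omega A B C M t x') <= (omega ^ 2 + G * (2 * M)) * Rabs (x - x')).
  { intros t x x'. unfold clamped_force.
    replace (- (omega ^ 2 * x + g omega A B C t * clamp M x ^ 2) -
             - (omega ^ 2 * x' + g omega A B C t * clamp M x' ^ 2))
      with (- (omega ^ 2 * (x - x')
              + g omega A B C t * (clamp M x ^ 2 - clamp M x' ^ 2))) by ring.
    rewrite Rabs_Ropp. eapply Rle_trans; [apply Rabs_triang|].
    rewrite !Rabs_mult, Rmult_plus_distr_r.
    destruct (Hg t) as [g0 g1].
    rewrite (Rabs_pos_eq (omega ^ 2)), (Rabs_pos_eq (g omega A B C t)) by assumption.
    apply Rplus_le_compat_l. rewrite Rmult_assoc.
    apply Rmult_le_compat; [exact g0|apply Rabs_pos|exact g1|].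
    now apply clamp_sqr_lipschitz. }
  destruct (picard_lindelof (clamped_force omega A B C M) (omega ^ 2 + G * (2 * M))
    (omega ^ 2 * Rabs z0 + G * M ^ 2) s z0 0) as [z [p [Hz [Hp HD]]]].
  - intros x t. apply (ex_derive_continuous (fun t => clamped_force omega A B C M t x)).
    assert (Q := alpha_bounds omega A B C t Ho).
    assert (Da := is_derive_alpha omega A B C t).
    unfold clamped_force, g, Rpower. auto_derive.
    repeat split; [eexists; exact Da|lra].
  - exact HL.
  - intro t. unfold clamped_force. rewrite Rabs_Ropp.
    eapply Rle_trans; [apply Rabs_triang|]. rewrite !Rabs_mult.
    destruct (Hg t) as [g0 g1].
    rewrite (Rabs_pos_eq (omega ^ 2)), (Rabs_pos_eq (g omega A B C t)) by assumption.
    apply Rplus_le_compat_l.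
    apply Rmult_le_compat; [exact g0|apply Rabs_pos|exact g1|].
    rewrite <- RPow_abs. apply pow_incr. split; [apply Rabs_pos|].
    apply Rabs_le. now apply clamp_bounds.
  - exists (omega ^ 2 + G * (2 * M)), z, p. auto.
Qed.

(** If [b] were finite, the global solution of the clamped equation would agree
    with the motion up to [b], and by continuity remain below the cut-off [M + 1]
    a little beyond [b] (and a little before [s]). There it solves the original
    equation, which contradicts maximality. *)
Lemma bounded_maximal_motion_global :
  forall omega A B C s z0 (a b : Rbar) z p M,
    0 < omega -> amplitude B C < A ->
    maximal_motion omega A B C s z0 a b z p ->
    (forall t, s <= t -> Rbar_lt t b -> Rabs (z t) <= M) ->
    b = p_infty.
Proof.
  intros omega A B C s z0 a b z p M Ho HA [[Has [Hsb [Hz0 [Hp0 Hm]]]] Hmax] HM.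
  destruct b as [b| |]; [exfalso|reflexivity|contradiction].
  simpl in Hsb.
  assert (HM0 : 0 <= M).
  { eapply Rle_trans; [apply Rabs_pos|]. apply (HM s); [lra|exact Hsb]. }
  destruct (clamped_motion_exists omega A B C (M + 1) s z0 Ho HA ltac:(lra))
    as [L [Z [P [HL [HZs [HPs HD]]]]]].
  assert (Heq : forall t, s <= t -> t < b -> z t = Z t).
  { intros t Hst Htb.
    apply (lipschitz_uniqueness (clamped_force omega A B C (M + 1)) L s t z p Z P Hst HL).
    - intros x [Hx1 Hx2].
      assert (Hax : Rbar_lt a x) by now apply (Rbar_lt_le_trans a s x).
      assert (Hxb : Rbar_lt x b) by (simpl; lra).
      unfold clamped_force. rewrite clamp_id; [now apply Hm|].
      assert (Q := HM x Hx1 Hxb). lra.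
    - intros x _. apply HD.
    - congruence.
    - congruence. }
  assert (HZc : forall t, exists d : posreal,
    forall x, Rabs (x - t) < d -> Rabs (Z x - Z t) < 1 / 2).
  { intro t. assert (Hc := is_derive_continuous Z t _ (proj1 (HD t))).
    assert (H12 : 0 < 1 / 2) by lra.
    destruct (proj1 (filterlim_locally _ _) Hc (mkposreal _ H12)) as [d Hd].
    exists d. exact Hd. }
  destruct (HZc s) as [ds Hds]. destruct (HZc b) as [db Hdb].
  assert (Pds := cond_pos ds). assert (Pdb := cond_pos db).
  assert (Hsmall : forall x, s - ds < x -> x < b + db -> Rabs (Z x) <= M + 1).
  { intros x Hx1 Hx2.
    destruct (Rlt_dec x s) as [Hxs|Hxs].
    - assert (Q : Rabs (Z x - Z s) < 1 / 2) by (apply Hds, Rabs_lt_between; lra).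
      assert (Qs := HM s (Rle_refl s) Hsb). rewrite Hz0, <- HZs in Qs.
      apply Rabs_lt_between in Q. apply Rabs_le_between in Qs.
      apply Rabs_le. lra.
    - destruct (Rlt_dec x b) as [Hxb|Hxb].
      + rewrite <- Heq by lra. assert (Q := HM x ltac:(lra) Hxb). lra.
      + (* A time before [b], where the bound on [z] holds, and close to [b]. *)
        set (t := Rmax s (b - db / 2)).
        assert (Ht1 : s <= t) by apply Rmax_l.
        assert (Ht2 : b - db / 2 <= t) by apply Rmax_r.
        assert (Ht3 : t < b) by (apply Rmax_lub_lt; lra).
        assert (Q1 : Rabs (Z x - Z b) < 1 / 2) by (apply Hdb, Rabs_lt_between; lra).
        assert (Q2 : Rabs (Z t - Z b) < 1 / 2) by (apply Hdb, Rabs_lt_between; lra).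
        assert (Q3 := HM t Ht1 Ht3). rewrite Heq in Q3 by assumption.
        apply Rabs_lt_between in Q1. apply Rabs_lt_between in Q2.
        apply Rabs_le_between in Q3. apply Rabs_le. lra. }
  destruct (Hmax (s - ds) (b + db) Z P) as [_ Hle].
  - split; [simpl; lra|]. split; [simpl; lra|]. split; [exact HZs|].
    split; [exact HPs|].
    intros t Ht1 Ht2. destruct (HD t) as [D1 D2]. split; [exact D1|].
    unfold clamped_force in D2. rewrite clamp_id in D2 by now apply Hsmall.
    exact D2.
  - simpl in Hle. lra.
Qed.

(** * The stroboscopic curve *)

Lemma z_crit_sqrt :
  forall omega A Rad, 0 < A + Rad ->
    z_crit omega A Rad = stiffness omega A Rad / 2 * sqrt (A + Rad).
Proof.
  intros omega A Rad H. unfold z_crit, stiffness.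
  rewrite Rpower_three_halves by exact H. field.
Qed.

(** In the rescaled position the stroboscopic curve is an energy level of the
    autonomous equation. *)
Lemma curve_level :
  forall omega A Rad z, 0 < A + Rad ->
    omega ^ 2 * (A - Rad) * z ^ 2 + 2 / 3 * Rpower (A + Rad) (- (3 / 2)) * z ^ 3
    = 2 * potential (stiffness omega A Rad) (z / sqrt (A + Rad)).
Proof.
  intros omega A Rad z H. unfold potential, stiffness.
  rewrite Rpower_Ropp, Rpower_three_halves by exact H.
  assert (Hr := sqrt_lt_R0 _ H). assert (Hrr := sqrt_sqrt _ (Rlt_le _ _ H)).
  set (r := sqrt (A + Rad)) in *.
  replace (A ^ 2 - Rad ^ 2) with ((A + Rad) * (A - Rad)) by ring.
  rewrite <- Hrr. field. lra.
Qed.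

Lemma continuous_pair :
  forall (f h : R -> R) (x : R), continuous f x -> continuous h x ->
    continuous (fun u => (f u, h u)) x.
Proof.
  intros f h x Hf Hh. apply filterlim_locally. intro eps.
  assert (H1 := proj1 (filterlim_locally _ _) Hf eps).
  assert (H2 := proj1 (filterlim_locally _ _) Hh eps).
  generalize (filter_and _ _ H1 H2). apply filter_imp.
  intros y [B1 B2]. now split.
Qed.

(** For [z <= z0] the potential does not exceed its value at [z0], so the equation
    of the curve can be solved for [p >= 0] as a function of [z]. The graph is an
    arc of the curve from [(z0, 0)] to points with [z] arbitrarily far to the
    left. *)
Lemma supercritical_curve_open :
  forall omega A Rad z0, 0 < omega -> 0 <= Rad < A ->
    z_crit omega A Rad < z0 -> curve_open omega A Rad z0.
Proof.
  intros omega A Rad z0 Ho HA Hz [M HM].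
  assert (Ha : 0 < A + Rad) by lra.
  set (K := stiffness omega A Rad).
  assert (HK : 0 < K).
  { unfold K, stiffness. apply Rmult_lt_0_compat; [apply pow_lt; lra|nra]. }
  rewrite z_crit_sqrt in Hz by exact Ha. fold K in Hz.
  assert (Hr := sqrt_lt_R0 _ Ha). set (r := sqrt (A + Rad)) in *.
  assert (Hz0 : 0 < z0) by nra.
  set (Z := - (Rabs M + 1)).
  set (w := fun u => z0 + u * (Z - z0)).
  set (h := fun u =>
    sqrt (2 * (potential K (z0 / r) - potential K (w u / r)) / (A + Rad))).
  assert (HZ : Z <= z0) by (unfold Z; assert (Q := Rabs_pos M); lra).
  destruct (HM (w 1, h 1)) as [HM1 _].
  - exists (fun u => (w u, h u)). repeat split.
    + intro u. apply continuous_pair.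
      * apply (ex_derive_continuous w). unfold w. auto_derive. trivial.
      * unfold h. apply (continuous_comp _ sqrt); [|apply continuous_sqrt].
        apply (ex_derive_continuous (fun u =>
          2 * (potential K (z0 / r) - potential K (w u / r)) / (A + Rad))).
        unfold w, potential. auto_derive. trivial.
    + assert (E : w 0 = z0) by (unfold w; ring).
      unfold h. rewrite E.
      replace (2 * (potential K (z0 / r) - potential K (z0 / r)) / (A + Rad))
        with 0 by (field; lra).
      now rewrite sqrt_0.
    + intros u [Hu0 Hu1]. unfold stroboscopic_curve. simpl fst. simpl snd.
      assert (E1 := curve_level omega A Rad (w u) Ha).
      assert (E0 := curve_level omega A Rad z0 Ha). fold K r in E0, E1.
      unfold h. rewrite pow2_sqrt.
      * rewrite Rplus_assoc, E1, E0. field. lra.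
      * apply Rdiv_le_0_compat; [|exact Ha].
        assert (Q : potential K (w u / r) <= potential K (z0 / r)); [|lra].
        apply potential_le; [exact HK| |].
        -- apply (Rmult_le_reg_r r); [exact Hr|]. unfold Rdiv at 2.
           rewrite Rmult_assoc, Rinv_l; lra.
        -- apply Rmult_le_compat_r; [now apply Rlt_le, Rinv_0_lt_compat|].
           unfold w. nra.
  - simpl in HM1. replace (w 1) with Z in HM1 by (unfold w; ring).
    unfold Z in HM1. rewrite Rabs_Ropp in HM1.
    assert (Q := Rle_abs M). assert (Q0 := Rabs_pos M).
    rewrite Rabs_pos_eq in HM1; lra.
Qed.

(** * Boundedness and escape *)

Lemma dalpha_le :
  forall omega B C t, 0 < omega ->
    Rabs (dalpha omega B C t) <= 2 * omega * amplitude B C.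
Proof.
  intros omega B C t Ho.
  assert (H := dalpha_sqr omega 0 B C t).
  assert (HR := amplitude_ge_0 B C).
  assert (Hp : 0 <= 2 * omega * amplitude B C) by (apply Rmult_le_pos; lra).
  rewrite <- (Rabs_pos_eq _ Hp). apply Rsqr_le_abs_0. unfold Rsqr.
  assert (Q : 0 <= 4 * omega ^ 2 * (alpha omega 0 B C t - 0) ^ 2).
  { apply Rmult_le_pos; [|apply pow2_ge_0].
    assert (0 <= omega ^ 2) by apply pow2_ge_0. lra. }
  lra.
Qed.

Lemma sqrt_alpha_bounds :
  forall omega A B C t, 0 < omega -> amplitude B C < A ->
    0 < sqrt (A - amplitude B C) <= sqrt (alpha omega A B C t) /\
    sqrt (alpha omega A B C t) <= sqrt (A + amplitude B C).
Proof.
  intros omega A B C t Ho HA.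
  assert (Q := alpha_bounds omega A B C t Ho).
  repeat split; [apply sqrt_lt_R0|apply sqrt_le_1_alt|apply sqrt_le_1_alt]; lra.
Qed.

Lemma bounded_from_rescaled :
  forall omega A B C z p t Y V, 0 < omega -> amplitude B C < A ->
    Rabs (rescaled_position omega A B C z t) <= Y ->
    Rabs (rescaled_momentum omega A B C z p t) <= V ->
    Rabs (z t) <= sqrt (A + amplitude B C) * Y /\
    Rabs (p t) <= (V + omega * amplitude B C * Y) / sqrt (A - amplitude B C).
Proof.
  intros omega A B C z p t Y V Ho HA HY HV.
  destruct (sqrt_alpha_bounds omega A B C t Ho HA) as [[Hm1 Hm2] Hr].
  assert (Hd := dalpha_le omega B C t Ho).
  set (y := rescaled_position omega A B C z t) in *.
  set (v := rescaled_momentum omega A B C z p t) in *.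
  set (r := sqrt (alpha omega A B C t)) in *.
  set (d := dalpha omega B C t) in *.
  assert (Ez : z t = r * y).
  { unfold y, rescaled_position. fold r. field. lra. }
  assert (Ep : p t = (v + d * y / 2) / r).
  { unfold v, y, rescaled_momentum, rescaled_position. fold r d. field. lra. }
  split.
  - rewrite Ez, Rabs_mult, (Rabs_pos_eq r) by lra.
    apply Rmult_le_compat; try apply Rabs_pos; lra.
  - rewrite Ep. unfold Rdiv at 1 3. rewrite Rabs_mult.
    apply Rmult_le_compat; try apply Rabs_pos.
    + eapply Rle_trans; [apply Rabs_triang|].
      apply Rplus_le_compat; [exact HV|].
      replace (d * y / 2) with (d * y * / 2) by field.
      rewrite !Rabs_mult, (Rabs_pos_eq (/ 2)) by lra.
      assert (Q : Rabs d * Rabs y <= 2 * omega * amplitude B C * Y)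
        by (apply Rmult_le_compat; auto; apply Rabs_pos).
      lra.
    + rewrite Rabs_pos_eq by (apply Rlt_le, Rinv_0_lt_compat; lra).
      apply Rinv_le_contravar; lra.
Qed.

Lemma rescaled_bounded :
  forall omega A B C z p t M, 0 < omega -> amplitude B C < A ->
    Rabs (z t) <= M -> Rabs (p t) <= M ->
    Rabs (rescaled_position omega A B C z t) <= M / sqrt (A - amplitude B C) /\
    Rabs (rescaled_momentum omega A B C z p t)
    <= sqrt (A + amplitude B C) * M
       + omega * amplitude B C * (M / sqrt (A - amplitude B C)).
Proof.
  intros omega A B C z p t M Ho HA Hz Hp.
  destruct (sqrt_alpha_bounds omega A B C t Ho HA) as [[Hm1 Hm2] Hr].
  assert (Hd := dalpha_le omega B C t Ho).
  assert (Hy : Rabs (rescaled_position omega A B C z t)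
               <= M / sqrt (A - amplitude B C)).
  { unfold rescaled_position, Rdiv. rewrite Rabs_mult.
    apply Rmult_le_compat; try apply Rabs_pos; [exact Hz|].
    rewrite Rabs_pos_eq by (apply Rlt_le, Rinv_0_lt_compat; lra).
    apply Rinv_le_contravar; lra. }
  split; [exact Hy|].
  replace (rescaled_momentum omega A B C z p t)
    with (sqrt (alpha omega A B C t) * p t
          + - (dalpha omega B C t * rescaled_position omega A B C z t * / 2))
    by (unfold rescaled_momentum, rescaled_position; field; lra).
  eapply Rle_trans; [apply Rabs_triang|]. rewrite Rabs_Ropp, !Rabs_mult.
  apply Rplus_le_compat.
  - rewrite Rabs_pos_eq by lra.
    apply Rmult_le_compat; try apply Rabs_pos; lra.
  - rewrite (Rabs_pos_eq (/ 2)) by lra.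
    assert (Q : Rabs (dalpha omega B C t) * Rabs (rescaled_position omega A B C z t)
      <= 2 * omega * amplitude B C * (M / sqrt (A - amplitude B C)))
      by (apply Rmult_le_compat; auto; apply Rabs_pos).
    lra.
Qed.

Lemma stiffness_pos :
  forall omega A B C, 0 < omega -> amplitude B C < A ->
    0 < stiffness omega A (amplitude B C).
Proof.
  intros omega A B C Ho HA. assert (HR := amplitude_ge_0 B C).
  unfold stiffness. apply Rmult_lt_0_compat; [apply pow_lt; lra|nra].
Qed.

(** At a maximum of [alpha] its derivative vanishes, so rest in [(z, p)] is rest in
    the rescaled variables, and the assumption on [z0] says that the rescaled
    position lies in the well. *)
Lemma subcritical_bounded :
  forall omega A B C s z0 (a b : Rbar) z p,
    0 < omega -> amplitude B C < A ->
    maximal_motion omega A B C s z0 a b z p ->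
    alpha omega A B C s = A + amplitude B C ->
    - 2 * z_crit omega A (amplitude B C) <= z0 < z_crit omega A (amplitude B C) ->
    bounded_motion s b z p.
Proof.
  intros omega A B C s z0 a b z p Ho HA Hmm Has Hz0.
  assert (HR := amplitude_ge_0 B C).
  assert (HK := stiffness_pos omega A B C Ho HA).
  rewrite z_crit_sqrt in Hz0 by lra.
  set (K := stiffness omega A (amplitude B C)) in *.
  destruct (proj1 Hmm) as [_ [_ [Ez [Ep _]]]].
  assert (Hf := motion_rescaled_flow omega A B C s z0 a b z p Ho HA (proj1 Hmm)).
  fold K in Hf.
  assert (Hds : dalpha omega B C s = 0).
  { assert (Q := dalpha_sqr omega A B C s). rewrite Has in Q.
    apply Rsqr_0_uniq. rewrite Rsqr_pow2, Q. ring. }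
  assert (Hr : 0 < sqrt (A + amplitude B C)) by (apply sqrt_lt_R0; lra).
  assert (Htrap := trapped_in_well K _ (/ (A - amplitude B C)) s b _ _ HK Hf).
  assert (Hw : forall t, s <= t -> Rbar_lt t b ->
     Rabs (rescaled_position omega A B C z t) <= K /\
     Rabs (rescaled_momentum omega A B C z p t) <= 1 + K ^ 3).
  { intros t Hst Htb. destruct (fun H1 H2 H3 => Htrap H1 H2 H3 t Hst Htb) as [Hy Hv].
    - intro x. assert (Q := alpha_bounds omega A B C x Ho). split.
      + apply Rinv_0_lt_compat. lra.
      + apply Rinv_le_contravar; lra.
    - unfold rescaled_momentum. rewrite Hds, Ep. field.
      rewrite Has. lra.
    - unfold rescaled_position. rewrite Has, Ez.
      set (r := sqrt (A + amplitude B C)) in *.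
      split.
      + apply (Rmult_le_reg_r r); [exact Hr|].
        replace (z0 / r * r) with z0 by (field; lra). lra.
      + apply (Rmult_lt_reg_r r); [exact Hr|].
        replace (z0 / r * r) with z0 by (field; lra). lra.
    - split; [apply Rabs_le; lra|].
      set (v := rescaled_momentum omega A B C z p t) in *.
      rewrite <- (pow2_abs v) in Hv.
      assert (Q := pow2_ge_0 (Rabs v - 1)). assert (Q' := pow2_ge_0 (Rabs v)). lra. }
  assert (Hb : forall t, s <= t -> Rbar_lt t b -> _ )
    by (intros t Hst Htb; destruct (Hw t Hst Htb) as [H1 H2];
        exact (bounded_from_rescaled omega A B C z p t _ _ Ho HA H1 H2)).
  split.
  - apply (bounded_maximal_motion_global omega A B C s z0 a b z p
             (sqrt (A + amplitude B C) * K) Ho HA Hmm).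
    intros t Hst Htb. apply (Hb t Hst Htb).
  - eexists (Rmax _ _). intros q [t [Hst [Htb ->]]]. simpl.
    destruct (Hb t Hst Htb) as [H1 H2]. split.
    + eapply Rle_trans; [exact H1|apply Rmax_l].
    + eapply Rle_trans; [exact H2|apply Rmax_r].
Qed.

(** Compared with a start at a maximum of [alpha], any other phase makes the rescaled
    initial position larger and adds kinetic energy through the rescaled momentum,
    so the energy exceeds the saddle level at every phase. *)
Lemma supercritical_leaves :
  forall omega A B C s z0 (a b : Rbar) z p,
    0 < omega -> amplitude B C < A ->
    maximal_motion omega A B C s z0 a b z p ->
    z_crit omega A (amplitude B C) < z0 ->
    leaves_bounded_domains s b z p.
Proof.
  intros omega A B C s z0 a b z p Ho HA Hmm Hz0 D [M HM].
  apply NNPP. intro Hin.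
  assert (Horb : forall t, s <= t -> Rbar_lt t b -> Rabs (z t) <= M /\ Rabs (p t) <= M).
  { intros t Hst Htb. apply (HM (z t, p t)). apply NNPP. intro Hout.
    apply Hin. exists (z t, p t). split; [|exact Hout].
    exists t. auto. }
  assert (Hb : b = p_infty).
  { apply (bounded_maximal_motion_global omega A B C s z0 a b z p M Ho HA Hmm).
    intros t Hst Htb. apply (Horb t Hst Htb). }
  subst b.
  assert (HR := amplitude_ge_0 B C).
  assert (HK := stiffness_pos omega A B C Ho HA).
  rewrite z_crit_sqrt in Hz0 by lra.
  set (K := stiffness omega A (amplitude B C)) in *.
  destruct (proj1 Hmm) as [_ [_ [Ez _]]].
  assert (Hf := motion_rescaled_flow omega A B C s z0 a p_infty z p Ho HA (proj1 Hmm)).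
  fold K in Hf.
  set (N1 := M / sqrt (A - amplitude B C)).
  set (N2 := sqrt (A + amplitude B C) * M + omega * amplitude B C * N1).
  refine (supercritical_unbounded K (fun t => / alpha omega A B C t)
    (/ (A + amplitude B C)) s _ _ (Rmax N1 N2) HK _ Hf _ _ _).
  - apply Rinv_0_lt_compat. lra.
  - intro t. assert (Q := alpha_bounds omega A B C t Ho).
    apply Rinv_le_contravar; lra.
  - assert (Hy : K / 2 < rescaled_position omega A B C z s).
    { unfold rescaled_position. rewrite Ez.
      destruct (sqrt_alpha_bounds omega A B C s Ho HA) as [[Hm1 Hm2] Hr].
      apply (Rmult_lt_reg_r (sqrt (alpha omega A B C s))); [lra|].
      unfold Rdiv at 2. rewrite Rmult_assoc, Rinv_l, Rmult_1_r by lra.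
      eapply Rle_lt_trans; [|exact Hz0]. apply Rmult_le_compat_l; lra. }
    assert (Q := potential_lt_saddle K _ HK Hy).
    assert (Q' := pow2_ge_0 (rescaled_momentum omega A B C z p s)). lra.
  - intros t Ht. destruct (Horb t Ht I) as [H1 H2].
    destruct (rescaled_bounded omega A B C z p t M Ho HA H1 H2) as [H3 H4].
    split.
    + eapply Rle_trans; [exact H3|apply Rmax_l].
    + eapply Rle_trans; [exact H4|apply Rmax_r].
Qed.

Theorem theorem1 :
  forall omega A B C phi : R,
    0 < omega ->
    (forall t : R,
       alpha omega A B C t = A + amplitude B C * cos (2 * omega * t - phi)) ->
    amplitude B C < A ->
    forall (s z0 : R) (a b : Rbar) (z p : R -> R),
      maximal_motion omega A B C s z0 a b z p ->
      (cos (2 * omega * s - phi) = 1 ->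
       - 2 * z_crit omega A (amplitude B C) <= z0 ->
       z0 < z_crit omega A (amplitude B C) ->
       bounded_motion s b z p) /\
      (z_crit omega A (amplitude B C) < z0 ->
       curve_open omega A (amplitude B C) z0 /\
       leaves_bounded_domains s b z p).
Proof.
  intros omega A B C phi Ho Hphi HA s z0 a b z p Hmm. split.
  - intros Hcos Hlo Hhi.
    apply (subcritical_bounded omega A B C s z0 a b z p Ho HA Hmm).
    + rewrite Hphi, Hcos. ring.
    + now split.
  - intro Hz0. split.
    + apply supercritical_curve_open; [exact Ho| |exact Hz0].
      split; [apply amplitude_ge_0|exact HA].
    + exact (supercritical_leaves omega A B C s z0 a b z p Ho HA Hmm Hz0).
Qed.
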